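(* For all real numbers $c_1,c_2>0$ and each real $\alpha\in[0,1)$ there is $n_0\in\mathbb{N}$ such that $f\left(n,\lfloor c_1 n^\alpha\rfloor\right)\ge c_2$ for all integers $n\ge n_0$.
   Context: One-dimensional Hegselmann--Krause (HK) system with strategic agents: there is a set $N=\{1,\dots,n\}$ of non-strategic agents and a disjoint set $S$ of $m=|S|$ strategic agents; $A=N\cup S$. At each discrete time $t\in\mathbb{N}_{\ge 0}$ every agent $i\in A$ has an opinion $x_i(t)\in\mathbb{R}$. The starting opinions $x_i(0)$, $i\in N$, are given. The opinions $x_s(t)$ of the strategic agents $s\in S$ can be chosen freely (as any real numbers) at every time $t$. For $i\in N$, $$x_i(t+1)=\frac{1}{|\mathcal{N}_i(t)|}\sum_{j\in\mathcal{N}_i(t)}x_j(t),\qquad \mathcal{N}_i(t)=\{j\in A: |x_i(t)-x_j(t)|\le 1\}.$$ The system has converged at time $t$ if for all $i,j\in N$ either $x_i(t)=x_j(t)$ or $|x_i(t)-x_j(t)|>1$. The convergence time is the smallest $t\in\mathbb{N}_{\ge 0}$ such that the system has converged at time $t$. For given starting opinions of the non-strategic agents and given $m$, the optimal convergence time is the minimum of the convergence time over all choices of the opinions of the $m$ strategic agents at all times. $f(n,m)$ denotes the supremum of the optimal convergence time over all starting opinions of $n$ non-strategic agents, with $m$ strategic agents. *)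

(* Defs.v *)
From HB Require Import structures.
From mathcomp Require Import all_boot all_order all_algebra.
From mathcomp Require Import all_classical all_reals all_analysis.

Set Implicit Arguments.
Unset Strict Implicit.
Unset Printing Implicit Defensive.

Import Order.TTheory GRing.Theory Num.Theory.

Local Open Scope ring_scope.

Section HegselmannKrause.
Variables (R : realType) (n m : nat).

(* Agents are 'I_n + 'I_m: [inl i] is non-strategic, [inr s] is strategic. *)
Definition opinion (x : 'I_n -> R) (y : 'I_m -> R) (a : 'I_n + 'I_m) : R :=
  match a with inl i => x i | inr s => y s end.

Definition neighbors (z : 'I_n + 'I_m -> R) (a : 'I_n + 'I_m) :
    {set 'I_n + 'I_m} :=
  [set b : 'I_n + 'I_m | `|z a - z b| <= 1]%SET.

Definition hk_step (x : 'I_n -> R) (y : 'I_m -> R) (i : 'I_n) : R :=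
  let z := opinion x y in
  (#|neighbors z (inl i)|%:R)^-1 * \sum_(b in neighbors z (inl i)) z b.

(* [y t s] is the opinion chosen for strategic agent [s] at time [t]. *)
Fixpoint hk (x0 : 'I_n -> R) (y : nat -> 'I_m -> R) (t : nat) : 'I_n -> R :=
  match t with
  | 0 => x0
  | t'.+1 => hk_step (hk x0 y t') (y t')
  end.

Definition converged (x : 'I_n -> R) : Prop :=
  forall i j : 'I_n, x i = x j \/ 1 < `|x i - x j|.

(* The smallest t at which the system has converged, and +oo if there is none:
   a nonempty set of natural numbers attains its infimum, and the infimum of the
   empty set is +oo. *)
Definition conv_time (x0 : 'I_n -> R) (y : nat -> 'I_m -> R) : \bar R :=
  ereal_inf [set (t%:R)%:E | t in [set t : nat | converged (hk x0 y t)]]%classic.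

(* A minimum, since conv_time takes its values in the natural numbers and +oo. *)
Definition opt_conv_time (x0 : 'I_n -> R) : \bar R :=
  ereal_inf [set conv_time x0 y | y in [set: nat -> 'I_m -> R]]%classic.

End HegselmannKrause.

Definition worst_opt_conv_time (R : realType) (n m : nat) : \bar R :=
  ereal_sup [set opt_conv_time m x0 | x0 in [set: 'I_n -> R]]%classic.

(* Main.v *)
(* Start from clusters of q agents at the sites 0, 3/4, 2 * 3/4, ... of a lattice.
   A cluster far from both ends sees exactly its two neighbouring clusters, which
   balance each other, so each step moves it only by the influence 2m/q of the
   strategic agents. For a bounded number of clusters and of steps this is o(1),
   because m = o(n). The unbalanced ends reach only boundedly many further
   clusters per step, so a long enough (but fixed) lattice keeps in its middle two
   clusters at distance about 3/4 up to any prescribed time. *)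
Require Import Defs.
From mathcomp Require Import all_boot all_order all_algebra.
From mathcomp Require Import all_classical all_reals all_analysis.
From mathcomp Require Import zify ring lra.

Import Order.TTheory GRing.Theory Num.Theory.

Local Open Scope ring_scope.

(** Agent [b] belongs to cluster [b %/ q]; the second hypothesis makes cluster [j] complete, since
    leftover agents can leave the last cluster short. *)
Lemma sum_divn_eq (n q j : nat) :
  (0 < q)%N -> (j.+1 * q <= n)%N -> (\sum_(b < n) (b %/ q == j) = q)%N.
Proof.
move=> q0 jn.
have lt_n (r : 'I_q) : (j * q + r < n)%N by have := ltn_ord r; lia.
have f_inj : injective (fun r => Ordinal (lt_n r)).
  by move=> r s /(congr1 val) /= /addnI /val_inj.
rewrite -[RHS]card_ord -cardsT -(card_imset _ f_inj) -sum1_card big_mkcond.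
rewrite [RHS]big_mkcond; apply: eq_bigr => b _ /=.
suff -> : (b \in [set Ordinal (lt_n r) | r in [set: 'I_q]]%SET)
   = (b %/ q == j)%N by case: eqP.
apply/imsetP/eqP => [[r _ ->] /=|bj].
  by rewrite divnMDl // divn_small ?addn0.
exists (Ordinal (ltn_pmod b q0)); first by rewrite inE.
by apply: val_inj; rewrite /= -bj -divn_eq.
Qed.

(** The outer clusters [j] and [j.+2] have equal size and pull with weights -1 and 1, so they
    cancel. *)
Lemma sum_divn_balanced (R : realType) (n q j : nat) :
  (0 < q)%N -> (j.+3 * q <= n)%N ->
  \sum_(b < n | (j <= b %/ q <= j.+2)%N) ((b %/ q)%N%:R - j.+1%:R) = 0 :> R.
Proof.
move=> q0 jn; rewrite big_mkcond /=.
have step (b : 'I_n) : true ->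
  (if (j <= b %/ q <= j.+2)%N then (b %/ q)%N%:R - j.+1%:R else 0)
  = (b %/ q == j.+2)%N%:R - (b %/ q == j)%N%:R :> R.
  move=> _; move: (b %/ q)%N => c.
  case: ifPn => Hc; last first.
    have [-> ->] : (c == j.+2) = false /\ (c == j) = false by split; lia.
    by rewrite subrr.
  have : c \in [:: j; j.+1; j.+2] by rewrite !inE; lia.
  have [N0 N1 N2] : [/\ (j == j.+2) = false, (j.+1 == j) = false
    & (j.+2 == j) = false] by split; lia.
  rewrite !inE => /or3P[] /eqP->;
    by rewrite ?eqxx ?eqSS ?N0 ?N1 ?N2 ?(eqn_leq j j.+1) ?ltnn ?andbF /= -?[j.+2%:R]natr1 -?[j.+1%:R]natr1; ring.
rewrite (eq_bigr _ step) sumrB -!natr_sum !sum_divn_eq ?subrr //.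
by rewrite (leq_trans _ jn)// leq_mul2r; lia.
Qed.

Lemma hk_step_sub (R : realType) (n m : nat) (x : 'I_n -> R) (y : 'I_m -> R)
    (a : 'I_n) (p : R) :
  let B := neighbors (opinion x y) (inl a) in
  hk_step x y a - p = #|B|%:R^-1 * \sum_(b in B) (opinion x y b - p).
Proof.
move=> B; have B0 : #|B|%:R != 0 :> R.
  rewrite pnatr_eq0 -lt0n; apply/card_gt0P; exists (inl a).
  by rewrite inE subrr normr0 ler01.
by rewrite sumrB sumr_const -(mulr_natr p) mulrBr mulrCA mulVf ?mulr1.
Qed.

Lemma hk_step_speed (R : realType) (n m : nat) (x : 'I_n -> R) (y : 'I_m -> R)
    (a : 'I_n) : `|hk_step x y a - x a| <= 1.
Proof.
rewrite hk_step_sub normrM ger0_norm ?invr_ge0 //.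
set B := neighbors _ _.
have B0 : 0 < #|B|%:R :> R.
  rewrite ltr0n; apply/card_gt0P; exists (inl a).
  by rewrite inE subrr normr0 ler01.
rewrite mulrC ler_pdivrMr // mul1r -sumr_const (le_trans (ler_norm_sum _ _ _)) //.
by apply: ler_sum => b; rewrite inE distrC.
Qed.

Section Lattice.
Variables (R : realType) (n m q : nat).
Hypothesis q0 : (0 < q)%N.

Let site (c : nat) : R := 3 / 4 * c%:R.

(** [near] and [far] force the non-strategic neighbours of [a] to be exactly clusters [j] to [j.+2]:
    adjacent ones are within 3/4 + 2e < 1. *)
Lemma hk_step_lattice (x : 'I_n -> R) (y : 'I_m -> R) (a : 'I_n) (j : nat) (e : R) :
  (j.+3 * q <= n)%N -> e <= 1 / 16 -> (a %/ q = j.+1)%N ->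
  (forall b : 'I_n, (j <= b %/ q <= j.+2)%N -> `|x b - site (b %/ q)| <= e) ->
  (forall b : 'I_n, ~~ (j <= b %/ q <= j.+2)%N -> 1 + e < `|x b - site j.+1|) ->
  `|hk_step x y a - site j.+1| <= e + m%:R * 2 / q%:R.
Proof.
move=> jn e16 aj near far; rewrite hk_step_sub.
set B := neighbors _ _.
have xa : `|x a - site j.+1| <= e by rewrite -aj near // aj leqnSn /=.
have e0 : 0 <= e := le_trans (normr_ge0 _) xa.
have inB (b : 'I_n) : (inl b \in B) = (j <= b %/ q <= j.+2)%N.
  rewrite inE /=; apply/idP/idP => [xab|Hb].
    apply: contraLR xab => /far fb; rewrite -ltNge.
    move: fb; rewrite (_ : x b - _ = (x a - site j.+1) - (x a - x b)); last by ring.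
    by move=> /lt_le_trans /(_ (ler_normB _ _)); lra.
  have : `|site (b %/ q) - site j.+1| <= 3 / 4.
    rewrite -mulrBr normrM ger0_norm ?ler_piMr //; try lra.
    move: Hb; move: (b %/ q)%N => c Hc.
    have : c \in [:: j; j.+1; j.+2] by rewrite !inE; lia.
    by rewrite !inE => /or3P[] /eqP->; rewrite -?natr1 ler_norml; apply/andP; split; lra.
  by move: xa (near b Hb); rewrite !ler_norml; move: (site _) (site _) => u v; lra.
(* The agents of cluster [j.+1] alone already give [q] neighbours. *)
have cardB : (q <= #|B|)%N.
  rewrite -[X in (X <= _)%N](@sum_divn_eq n q j.+1) //; last first.
    by rewrite (leq_trans _ jn)// leq_mul2r; lia.
  rewrite -sum1_card big_sumType /= (leq_trans _ (leq_addr _ _)) //.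
  rewrite [leqRHS]big_mkcond leq_sum // => b _; rewrite inB.
  by case: (b %/ q =P j.+1)%N => [->|_] //; rewrite !leqnSn.
have B0 : 0 < #|B|%:R :> R by rewrite ltr0n (leq_trans q0).
rewrite normrM ger0_norm ?invr_ge0 // mulrC ler_pdivrMr //.
have ns : `|\sum_(b in B) (opinion x y b - site j.+1)| <= e * #|B|%:R + m%:R * 2.
  rewrite big_sumType /= (eq_bigl _ _ inB).
  (* By balance, deviations may be measured from each agent's own site, where they are at most
     [e]. *)
  have -> : \sum_(b < n | (j <= b %/ q <= j.+2)%N) (x b - site j.+1)
    = \sum_(b < n | (j <= b %/ q <= j.+2)%N) (x b - site (b %/ q)).
    have := congr1 ( *%R (3 / 4)) (sum_divn_balanced R _ _ _ q0 jn).
    rewrite mulr0 => bal; apply/eqP; rewrite -subr_eq0 -sumrB; apply/eqP.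
    by apply: etrans bal; rewrite mulr_sumr; apply: eq_bigr => b _; rewrite /site; ring.
  apply: (le_trans (ler_normD _ _)); apply: lerD.
    apply: (le_trans (ler_norm_sum _ _ _)).
    apply: (@le_trans _ _ (\sum_(b < n | (j <= b %/ q <= j.+2)%N) e)).
      by apply: ler_sum => b /near.
    rewrite sumr_const -(mulr_natr e) ler_wpM2l // ler_nat -!sum1_card big_sumType /=.
    by rewrite (eq_bigl _ _ inB) leq_addr.
  apply: (le_trans (ler_norm_sum _ _ _)).
  (* A strategic neighbour of [a] is within 1 + e <= 2 of the site. *)
  apply: (@le_trans _ _ (\sum_(s < m | inr s \in B) 2)).
    apply: ler_sum => s; rewrite inE /= => ys.
    by move: xa ys; rewrite !ler_norml; move: (site _) => u; lra.
  rewrite sumr_const -(mulr_natr 2) mulrC ler_wpM2r // ler_nat.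
  by rewrite (leq_trans (max_card _)) // card_ord.
apply: (le_trans ns); rewrite mulrDl lerD2l.
rewrite mulrAC ler_pdivlMr ?ltr0n // ler_wpM2l ?mulr_ge0 // ler_nat //.
Qed.

Lemma hk_speed (x0 : 'I_n -> R) (y : nat -> 'I_m -> R) (t : nat) (a : 'I_n) :
  `|hk x0 y t a - x0 a| <= t%:R.
Proof.
elim: t => [|t IH] /=; first by rewrite subrr normr0.
rewrite -(subrKA (hk x0 y t a)) (le_trans (ler_normD _ _)) // -natr1 addrC lerD //.
exact: hk_step_speed.
Qed.

(* The free ends of the lattice disturb at most K further sites per step, since
   agents have speed at most 1. *)
Lemma hk_lattice (y : nat -> 'I_m -> R) (T k : nat) :
  let K := (T.*2 + 4)%N in
  (k * q <= n)%N -> T%:R * (m%:R * 2 / q%:R) <= 1 / 16 :> R ->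
  forall t (a : 'I_n), (t <= T)%N -> (K * t <= a %/ q)%N -> (a %/ q + K * t < k)%N ->
  `|hk (fun b : 'I_n => site (b %/ q)) y t a - site (a %/ q)|
    <= t%:R * (m%:R * 2 / q%:R).
Proof.
move=> K kn dT; set d := m%:R * 2 / q%:R in dT *.
have d0 : 0 <= d by rewrite !mulr_ge0 ?invr_ge0.
elim=> [|t IH] a tT lo hi /=; first by rewrite subrr normr0 mul0r.
have e16 : t%:R * d <= 1 / 16.
  by apply: le_trans dT; rewrite ler_wpM2r // ler_nat ltnW.
have [j aj] : exists j, (a %/ q = j.+1)%N by exists (a %/ q).-1; lia.
rewrite aj -natr1 mulrDl mul1r.
have K4 : (4 <= K)%N by rewrite /K; lia.
have Kt : (K * t.+1 = K * t + K)%N by rewrite mulnS addnC.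
have tK : (t.*2 + 4 <= K)%N by rewrite /K; lia.
apply: hk_step_lattice => // [|b Hb|b Hb].
- by rewrite (leq_trans _ kn) // leq_mul2r; lia.
- by apply: IH; lia.
set c := (b %/ q)%N in Hb *.
have sep (u : R) (l : nat) : `|u - site c| <= 3 / 4 * l%:R - (1 + t%:R * d) - 1 / 16 ->
  (c + l <= j.+1)%N \/ (j.+1 + l <= c)%N -> 1 + t%:R * d < `|u - site j.+1|.
  rewrite ltr_normr ler_norml /site => /andP[u1 u2].
  rewrite -![(_ <= _)%N](ler_nat R) !natrD => H; apply/orP.
  by move: H u1 u2; set z := t%:R * d; case=> H u1 u2; [right|left]; lra.
(* Inside the window the induction hypothesis controls [b], whose site is at least two away, at
   distance 3/2 or more. Outside it, [b] starts at least [K] sites away and has moved by at most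
   [t], which is less than 3K/4 - 1 by enough. *)
have [win|out] := boolP ((K * t <= c) && (c + K * t < k))%N.
  apply: (sep _ 2%N); last by lia.
  have /= := IH b (ltnW tT); case/andP: win => w1 w2 /(_ w1 w2); rewrite -/c; lra.
apply: (sep _ K); last by lia.
apply: (le_trans (hk_speed _ _ t b)).
have : (t.*2 + 4)%:R <= K%:R :> R by rewrite ler_nat.
rewrite natrD -mul2n natrM; have : 0 <= t%:R :> R by []. lra.
Qed.

(** Clusters [K * T] and [(K * T).+1] are still undisturbed at time [T]. Each is within 1/16 of its
    site, so their distance lies between 5/8 and 7/8: neither 0 nor above 1. *)
Lemma hk_lattice_not_converged (y : nat -> 'I_m -> R) (T : nat) :
  let K := (T.*2 + 4)%N in
  (((K * T).*2 + 3) * q <= n)%N -> T%:R * (m%:R * 2 / q%:R) <= 1 / 16 :> R ->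
  forall t, (t <= T)%N ->
  ~ converged (hk (fun b : 'I_n => site (b %/ q)) y t).
Proof.
move=> K kn dT t tT.
have KtT : (K * t <= K * T)%N by rewrite leq_mul2l tT orbT.
have lt1 : (K * T * q < n)%N by rewrite (leq_trans _ kn) // ltn_pmul2r //; lia.
have lt2 : ((K * T).+1 * q < n)%N by rewrite (leq_trans _ kn) // ltn_pmul2r //; lia.
have e16 : t%:R * (m%:R * 2 / q%:R) <= 1 / 16 :> R.
  by apply: le_trans dT; rewrite ler_wpM2r ?mulr_ge0 ?invr_ge0 // ler_nat.
have := @hk_lattice y T _ kn dT t (Ordinal lt1) tT.
have := @hk_lattice y T _ kn dT t (Ordinal lt2) tT.
rewrite /= !mulnK // -/K => H2 H1.
have {}H1 := le_trans (H1 ltac:(lia) ltac:(lia)) e16.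
have {}H2 := le_trans (H2 ltac:(lia) ltac:(lia)) e16.
move=> /(_ (Ordinal lt1) (Ordinal lt2)).
move: H1 H2; rewrite !ler_norml /site -(natr1 (K * T)) => /andP[? ?] /andP[? ?].
by case=> [H|]; [|rewrite ltr_normr => /orP[]]; lra.
Qed.

End Lattice.

Lemma ge_worst_opt_conv_time (R : realType) (n m T : nat) (x0 : 'I_n -> R) :
  (forall y t, (t < T)%N -> ~ converged (hk (m := m) x0 y t)) ->
  (T%:R%:E <= worst_opt_conv_time R n m)%E.
Proof.
move=> H; apply: (@le_trans _ _ (opt_conv_time m x0)); last first.
  by apply: ereal_sup_ubound; exists x0.
apply: le_ereal_inf_tmp => _ [y _ <-]; apply: le_ereal_inf_tmp => _ [t Ht <-].
by rewrite lee_fin ler_nat leqNgt; apply/negP => /(H y); exact.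
Qed.

(** Split n as the product of its powers 1 - alpha and alpha; the first factor exceeds |M| once n
    exceeds |M| to the power 1 / (1 - alpha). *)
Lemma powR_sublinear (R : realType) (M alpha : R) : alpha < 1 ->
  exists n0 : nat, forall n : nat, (n0 <= n)%N -> M * n%:R `^ alpha <= n%:R.
Proof.
move=> a1; have b0 : 0 < 1 - alpha by rewrite subr_gt0.
exists (Num.truncn (`|M| `^ (1 - alpha)^-1)).+1 => n n0n.
have n_gt0 : 0 < n%:R :> R by rewrite ltr0n (leq_trans _ n0n).
have nE : n%:R = n%:R `^ (1 - alpha) * n%:R `^ alpha :> R.
  by rewrite -powRD ?subrK ?powRr1 // ?gt_eqF // implybT.
rewrite [leRHS]nE ler_wpM2r ?powR_ge0 // (le_trans (ler_norm M)) //.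
suff : (`|M| `^ (1 - alpha)^-1) `^ (1 - alpha) <= n%:R `^ (1 - alpha).
  by rewrite -powRrM mulVf ?gt_eqF // powRr1.
apply: ge0_ler_powR; rewrite ?nnegrE ?powR_ge0 ?ltW //.
by rewrite (lt_le_trans (truncnS_gt _)) // ler_nat.
Qed.

Theorem lemma16 (R : realType) (c1 c2 alpha : R) (hc1 : 0 < c1) (hc2 : 0 < c2)
    (halpha0 : 0 <= alpha) (halpha1 : alpha < 1) :
  exists n0 : nat, forall n : nat, (n0 <= n)%N ->
    (c2%:E <= worst_opt_conv_time R n (Num.truncn (c1 * (n%:R `^ alpha))))%E.
Proof.
set T := (Num.truncn c2).+1; set k := (((T.*2 + 4) * T).*2 + 3)%N.
(* A total drift T * 2m/q <= 1/16 requires 32Tm <= q; the further factor 2 in 64 pays for rounding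
   in [q = n %/ k]. *)
have [n0 Hn0] := powR_sublinear _ ((64 * T * k)%:R * c1) _ halpha1.
exists (maxn n0 k) => n; rewrite geq_max => /andP[/Hn0 {}Hn0 kn].
set m := Num.truncn _.
have k0 : (0 < k)%N by rewrite /k addnS.
have q0 : (0 < n %/ k)%N by rewrite divn_gt0.
have small : (64 * T * k * m <= n)%N.
  rewrite -(ler_nat R) natrM (le_trans _ Hn0) // -mulrA ler_wpM2l //.
  by rewrite truncn_le mulr_ge0 ?powR_ge0 ?ltW.
(* As q >= 1, n < (q + 1)k <= 2qk. *)
have mq : (32 * T * m <= n %/ k)%N.
  by have := ltn_ceil n k0; move: (n %/ k)%N q0 small k0 => q; nia.
apply: (@le_trans _ _ (T%:R%:E)); first by rewrite lee_fin ltW ?truncnS_gt.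
apply: ge_worst_opt_conv_time => /= y t /ltnW tT.
apply: (hk_lattice_not_converged R n m _ q0 y T) tT.
  by rewrite mulnC leq_divM.
rewrite !mulrA ler_pdivrMr ?ltr0n //.
by move: mq; rewrite -(ler_nat R) !natrM; lra.
Qed.
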